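(* Let $X$ be a compact metric space and $f_{0,\infty}=\{f_n\}_{n=0}^\infty$ a sequence of continuous self-maps of $X$. If $(X,f_{0,\infty})$ is weakly mixing of all orders, then so is $(\mathcal{M}(X),\hat f_{0,\infty})$. Conversely, if $(\mathcal{M}(X),\hat f_{0,\infty})$ is weakly mixing of some order $n\ge2$, then $(X,f_{0,\infty})$ is weakly mixing of order $n$.
   Context: Let $(X,d)$ be a compact metric space. A non-autonomous dynamical system $(X,f_{0,\infty})$ is given by a sequence $f_{0,\infty}=\{f_n\}_{n=0}^\infty$ of continuous self-maps of $X$; write $f_0^n=f_{n-1}\circ\cdots\circ f_0$ for $n\ge1$. $\mathcal{M}(X)$ is the space of all Borel probability measures on $X$ with the Prohorov metric $\mathcal{P}_d(\mu,\nu)=\inf\{\epsilon>0:\mu(A)\le\nu(A^\epsilon)+\epsilon \text{ and } \nu(A)\le\mu(A^\epsilon)+\epsilon \text{ for all Borel } A\subset X\}$, where $A^\epsilon=\{x\in X: d(x,A)<\epsilon\}$; its topology is the weak$^*$-topology and $\mathcal{M}(X)$ is a compact metric space. The induced system $(\mathcal{M}(X),\hat f_{0,\infty})$, $\hat f_{0,\infty}=\{\hat f_n\}_{n=0}^\infty$, consists of the continuous maps $\hat f_n(\mu)(A)=\mu(f_n^{-1}(A))$. For nonempty open $U,V\subset X$ let $N(U,V)=\{n\ge1: f_0^n(U)\cap V\neq\emptyset\}$. $(X,f_{0,\infty})$ is weakly mixing of order $n$ if $\bigcap_{i=1}^n N(U_i,V_i)\ne\emptyset$ for any nonempty open subsets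 $U_1,\dots,U_n,V_1,\dots,V_n$ of $X$; it is weakly mixing of all orders if it is weakly mixing of order $n$ for every $n\ge2$. *)

(* Defs.v *)
From HB Require Import structures.
From mathcomp Require Import all_boot all_order all_algebra.
From mathcomp Require Import all_classical all_reals all_analysis.

Set Implicit Arguments.
Unset Strict Implicit.
Unset Printing Implicit Defensive.

Import Order.TTheory GRing.Theory Num.Theory.
Import numFieldNormedType.Exports.

Local Open Scope classical_set_scope.
Local Open Scope ring_scope.

Section nonautonomous_systems.
Context {T : topologicalType}.
Implicit Types (f : nat -> T -> T) (U V : set T).

(* f_0^n = f_(n-1) \o ... \o f_0 *)
Fixpoint orbit_map f (n : nat) : T -> T :=
  if n is m.+1 then f m \o orbit_map f m else id.

Definition hitting_times f U V : set nat :=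
  [set n | (1 <= n)%N /\ (orbit_map f n @` U) `&` V !=set0].

Definition weakly_mixing f (n : nat) : Prop :=
  forall U V : 'I_n -> set T,
    (forall i, open (U i) /\ U i !=set0) ->
    (forall i, open (V i) /\ V i !=set0) ->
    \bigcap_(i in [set: 'I_n]) hitting_times f (U i) (V i) !=set0.

Definition weakly_mixing_all_orders f : Prop :=
  forall n : nat, (2 <= n)%N -> weakly_mixing f n.

End nonautonomous_systems.

(* Measurable types are pointed in the library, hence so is the base space. *)
#[short(type="pointedMetricType")]
HB.structure Definition PointedMetric (K : numDomainType) :=
  {M of Pointed M & Metric K M}.

Definition borel {R : realType} (X : pointedMetricType R) :
    measurableType (@open X).-sigma :=
  g_sigma_algebraType (@open X).

Definition borel_probability {R : realType} (X : pointedMetricType R) : Type :=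
  probability (borel X) R.

HB.instance Definition _ {R : realType} (X : pointedMetricType R) :=
  Pointed.on (borel_probability X).

Section prohorov.
Context {R : realType} {X : pointedMetricType R}.
Implicit Types (A : set X) (mu nu : borel_probability X).

(* As an extended real: the distance to the empty set is +oo. *)
Definition set_dist (x : X) A : \bar R :=
  ereal_inf [set (mdist x a)%:E | a in A].

Definition thickening A (e : R) : set X := [set x | (set_dist x A < e%:E)%E].

Definition prohorov_radii mu nu : set R :=
  [set e | 0 < e /\ forall A, measurable (A : set (borel X)) ->
     (mu A <= nu (thickening A e) + e%:E)%E /\
     (nu A <= mu (thickening A e) + e%:E)%E].

Definition prohorov mu nu : R := inf (prohorov_radii mu nu).

Lemma thickeningP A e x :
  thickening A e x <-> exists2 a, A a & mdist x a < e.
Proof.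
rewrite /thickening /set_dist /=; split.
  by move=> /ereal_inf_lt[_ [a Aa <-]]; rewrite lte_fin; exists a.
move=> [a Aa xa]; apply: (@le_lt_trans _ _ (mdist x a)%:E).
  by apply: ereal_inf_lbound; exists a.
by rewrite lte_fin.
Qed.

Lemma open_thickening A e : open (thickening A e).
Proof.
rewrite openE => x /thickeningP[a Aa xa]; apply/nbhs_ballP.
exists (e - mdist x a) => /=; first by rewrite subr_gt0.
move=> y; rewrite ballEmdist /= => xy; apply/thickeningP; exists a => //.
rewrite (le_lt_trans (metric_triangle _ x _))// metric_sym.
by rewrite -ltrBrDr.
Qed.

Lemma measurable_thickening A e : measurable (thickening A e : set (borel X)).
Proof. by apply: sub_sigma_algebra; exact: open_thickening. Qed.

Lemma sub_thickening A e : 0 < e -> A `<=` thickening A e.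
Proof. by move=> e0 x Ax; apply/thickeningP; exists x => //; rewrite mdistxx. Qed.

Lemma thickeningD A e1 e2 :
  thickening (thickening A e1) e2 `<=` thickening A (e1 + e2).
Proof.
move=> x /thickeningP[y /thickeningP[a Aa ya] xy]; apply/thickeningP.
exists a => //; rewrite (le_lt_trans (metric_triangle _ y _))//.
by rewrite addrC ltrD.
Qed.

Lemma has_inf_prohorov_radii mu nu : has_inf (prohorov_radii mu nu).
Proof.
split; last by exists 0 => e [/ltW].
exists 1; split => // A mA.
have le1 (m m' : borel_probability X) : (m A <= m' (thickening A 1) + 1%:E)%E.
  rewrite (le_trans (probability_le1 m mA))// leeDr//.
by split; exact: le1.
Qed.

Lemma prohorov_sym mu nu : prohorov mu nu = prohorov nu mu.
Proof.
by congr inf; apply/seteqP; split=> e [e0 h]; split => // A /h[].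
Qed.

Lemma prohorovxx mu : prohorov mu mu = 0.
Proof.
have [_ lb] := has_inf_prohorov_radii mu mu.
apply/eqP; rewrite eq_le; apply/andP; split; last first.
  by apply: lb_le_inf => [|e [/ltW]//]; case: (has_inf_prohorov_radii mu mu).
apply/ler_addgt0Pl => e e0; rewrite addr0; apply: ge_inf => //; split => // A mA.
suff: (mu A <= mu (thickening A e) + e%:E)%E by [].
rewrite (@le_trans _ _ (mu (thickening A e)))//.
  apply: le_measure; rewrite ?inE//; first exact: measurable_thickening.
  exact: sub_thickening.
by rewrite leeDl// lee_fin ltW.
Qed.

Lemma prohorov_triangle nu mu rho :
  prohorov mu rho <= prohorov mu nu + prohorov nu rho.
Proof.
have [_ lb] := has_inf_prohorov_radii mu rho.
have [ne1 lb1] := has_inf_prohorov_radii mu nu.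
have [ne2 lb2] := has_inf_prohorov_radii nu rho.
rewrite -lerBlDr; apply: lb_le_inf => // e1 [e10 h1].
rewrite lerBlDr addrC -lerBlDr; apply: lb_le_inf => // e2 [e20 h2].
rewrite lerBlDr addrC; apply: ge_inf => //; split; first exact: addr_gt0.
have step (m1 m2 m3 : borel_probability X) (a b : R) A :
    (m1 A <= m2 (thickening A a) + a%:E)%E ->
    (m2 (thickening A a) <= m3 (thickening (thickening A a) b) + b%:E)%E ->
    (m1 A <= m3 (thickening A (a + b)) + (a + b)%:E)%E.
  move=> h12 h23; rewrite (le_trans h12)// EFinD [(a%:E + b%:E)%E]addeC addeA.
  rewrite leeD2r// (le_trans h23)// leeD2r//.
  apply: le_measure; rewrite ?inE; [exact: measurable_thickening..|].
  exact: thickeningD.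
move=> A mA; split.
  by apply: step (proj1 (h1 A mA)) _; apply: (h2 _ _).1; exact: measurable_thickening.
rewrite [e1 + e2]addrC.
by apply: step (proj2 (h2 A mA)) _; apply: (h1 _ _).2; exact: measurable_thickening.
Qed.

End prohorov.

(* M(X) carries the topology of the Prohorov metric. The structure is only
   pseudometric because a [probability] also assigns (meaningless) values to
   non-measurable sets: probabilities that agree on all Borel sets are at
   distance 0, hence topologically indistinguishable, without being equal. *)
Section prohorov_topology.
Context {R : realType} {X : pointedMetricType R}.

Let M := borel_probability X.

Let ball (mu : M) (e : R) : set M := [set nu | prohorov mu nu < e].

Let ent : set_system (M * M) := entourage_ ball.

Let nbhs (mu : M) : set_system M := nbhs_ ent mu.

Let nbhsE : nbhs = nbhs_ ent. Proof. by []. Qed.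

HB.instance Definition _ := hasNbhs.Build (borel_probability X) nbhs.

Let ball_center mu (e : R) : 0 < e -> ball mu e mu.
Proof. by move=> e0; rewrite /ball /= prohorovxx. Qed.

Let ball_sym mu nu (e : R) : ball mu e nu -> ball nu e mu.
Proof. by rewrite /ball /= prohorov_sym. Qed.

Let ball_triangle mu nu rho e1 e2 :
  ball mu e1 nu -> ball nu e2 rho -> ball mu (e1 + e2) rho.
Proof.
by rewrite /ball /= => ? ?; rewrite (le_lt_trans (prohorov_triangle nu _ _))// ltrD.
Qed.

Let entourageE : ent = entourage_ ball. Proof. by []. Qed.

HB.instance Definition _ := @Nbhs_isPseudoMetric.Build R (borel_probability X)
  ent nbhsE ball ball_center ball_sym ball_triangle entourageE.

End prohorov_topology.

Lemma ball_prohorov {R : realType} {X : pointedMetricType R}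
    (mu : borel_probability X) (e : R) :
  ball mu e = [set nu | prohorov mu nu < e].
Proof. by []. Qed.

Section induced_system.
Context {R : realType} {X : pointedMetricType R}.

Lemma continuous_borel_measurable (g : X -> X) :
  continuous g -> measurable_fun [set: borel X] (g : borel X -> borel X).
Proof.
move=> cg; apply: (@measurability _ _ (borel X) (borel X) _ _ (@open X)) => //.
move=> _ [B oB <-].
by rewrite setTI; apply: sub_sigma_algebra; move/continuousP : cg; apply.
Qed.

Definition induced_map (g : X -> X) (cg : continuous g)
    (mu : borel_probability X) : borel_probability X :=
  distribution mu (mfun_Sub (mem_set (continuous_borel_measurable cg))).

Lemma induced_mapE (g : X -> X) (cg : continuous g) mu (A : set X) :
  induced_map cg mu A = mu (g @^-1` A).
Proof. by []. Qed.

Definition induced_system (f : nat -> X -> X) (cf : forall n, continuous (f n))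
    (n : nat) : borel_probability X -> borel_probability X :=
  induced_map (cf n).

End induced_system.

(* Main.v *)
(* A probability on a compact metric space is approximated, in the Prohorov
   metric, by an average of N Dirac masses, with N depending on the accuracy
   only: cut X into m small Borel pieces and round the weights down to
   multiples of 1/N, which loses at most m/N.  Moving each atom a little moves
   the average little, so weak mixing of order n N on X, applied to balls around
   all the atoms, yields weak mixing of order n on M(X).  Conversely, near a
   Dirac mass at a point of U every probability gives U more than half of the
   mass; if mu gives more than half to both U and the preimage of V, these two
   sets meet. *)
Require Import Defs.
From HB Require Import structures.
From mathcomp Require Import all_boot all_order all_algebra.
From mathcomp Require Import all_classical all_reals all_analysis.
From mathcomp Require Import lra.

Local Open Scope classical_set_scope.

Set Implicit Arguments.
Unset Strict Implicit.
Unset Printing Implicit Defensive.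
Import Order.TTheory GRing.Theory Num.Theory.
Local Open Scope ring_scope.

(* Each weight is rounded down to a multiple of [1 / N]; the indices left over
   are sent to [ord0]. *)
Lemma quantize_weights (R : realType) (m N : nat) (p : 'I_m.+1 -> R) :
    (forall j, 0 <= p j) -> \sum_j p j <= 1 ->
  exists g : 'I_N -> 'I_m.+1, forall J : pred 'I_m.+1,
    N%:R * \sum_(j | J j) p j <= \sum_(i < N) (J (g i))%:R + m.+1%:R.
Proof.
move=> p0 p1; pose k j := Num.truncn (N%:R * p j).
have kle j : (k j)%:R <= N%:R * p j.
  by have /andP[] := truncn_itv (mulr_ge0 (ler0n R N) (p0 j)).
have klt j : N%:R * p j <= (k j)%:R + 1 by rewrite natr1 ltW// truncnS_gt.
pose s := flatten [seq nseq (k j) j | j <- enum 'I_m.+1].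
have count_s J : count J s = (\sum_(j | J j) k j)%N.
  rewrite count_flatten -map_comp sumnE big_map big_enum [RHS]big_mkcond /=.
  by apply: eq_bigr => j _; rewrite count_nseq; case: (J j); rewrite ?mul1n ?mul0n.
(* The rounded-down weights add up to at most [N], so the list [s] fits into [N] slots. *)
have sN : (size s <= N)%N.
  rewrite -count_predT count_s -(ler_nat R) natr_sum.
  apply: (@le_trans _ _ (\sum_j N%:R * p j)); first exact: ler_sum.
  by rewrite -mulr_sumr ler_piMr.
exists (fun i => nth ord0 s i) => J.
have le_count : ((\sum_(j | J j) k j) <= \sum_(i < N) J (nth ord0 s i))%N.
  rewrite -count_s -sum1_count (big_nth ord0) big_mkcond/=.
  rewrite -[leqRHS](big_mkord xpredT (fun i => nat_of_bool (J (nth ord0 s i)))).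
  rewrite [leqRHS](big_cat_nat (n := size s))//=.
  by rewrite (leq_trans _ (leq_addr _ _))// leq_sum// => i _; case: ifP.
apply: (@le_trans _ _ ((\sum_(j | J j) k j)%:R + m.+1%:R)); last first.
  by rewrite lerD2r -natr_sum ler_nat.
(* Rounding costs less than 1 per index of [J], and there are at most [m.+1] of them. *)
rewrite mulr_sumr (le_trans (ler_sum _ (fun j _ => klt j)))// big_split/=.
rewrite natr_sum lerD2l sumr_const ler_nat.
by rewrite -[leqRHS]card_ord max_card.
Qed.

(** Reindexing along the enumeration of [J]; it is meant for index sets that are products. *)
Lemma weakly_mixing_fin (T : topologicalType) (f : nat -> T -> T) (J : finType)
    (U V : J -> set T) :
    weakly_mixing f #|J| ->
    (forall i, open (U i) /\ U i !=set0) ->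
    (forall i, open (V i) /\ V i !=set0) ->
  exists k, forall i, hitting_times f (U i) (V i) k.
Proof.
move=> wm oU oV.
have [k hk] := wm (U \o enum_val) (V \o enum_val)
  (fun i => oU (enum_val i)) (fun i => oV (enum_val i)).
by exists k => i; have := hk (enum_rank i) I; rewrite /= enum_rankK.
Qed.

Lemma continuous_orbit_map (T : topologicalType) (f : nat -> T -> T) k :
  (forall n, continuous (f n)) -> continuous (orbit_map f k).
Proof.
move=> cf; elim: k => [|k IH] x /=; first exact: cvg_id.
by apply: continuous_comp; [exact: IH | exact: cf].
Qed.

(** * Averages of Dirac masses *)

Section empirical.
Context {R : realType} {X : pointedMetricType R}.
Variable N : nat.
Implicit Type x : 'I_N.+1 -> X.

(** [msum] takes a family indexed by [nat], hence [inord]; having [N.+1] atoms keeps the weight from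
    being the inverse of zero. *)
Definition empirical x : set (borel X) -> \bar R :=
  mscale (N.+1%:R^-1)%:nng
    (msum (fun i => \d_(x (inord i) : borel X)) N.+1).

HB.instance Definition _ x := Measure.on (empirical x).

Lemma empiricalE x A :
  empirical x A = (N.+1%:R^-1 * \sum_(i < N.+1) (x i \in A)%:R)%:E.
Proof.
rewrite /empirical /mscale /msum /= EFinM -sumEFin; congr (_ * _)%E.
by apply: eq_bigr => i _; rewrite inord_val.
Qed.

Let empirical_setT x : empirical x setT = 1%E.
Proof.
rewrite empiricalE (eq_bigr (fun=> 1)) => [|i _]; last by rewrite in_setT.
by rewrite sumr_const card_ord mulVf// pnatr_eq0.
Qed.

HB.instance Definition _ x :=
  Measure_isProbability.Build _ _ _ (empirical x) (empirical_setT x).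
End empirical.

(** * Prohorov estimates and approximation by empirical measures *)

Section prohorov_bounds.
Context {R : realType} {X : pointedMetricType R}.
Implicit Types (mu nu : borel_probability X) (e : R).

(* The reverse inequality for [A] is this one for the complement of [A^e],
   whose thickening avoids [A]. *)
Lemma prohorov_le mu nu e : 0 < e ->
    (forall A, measurable (A : set (borel X)) ->
      (mu A <= nu (thickening A e) + e%:E)%E) ->
  prohorov mu nu <= e.
Proof.
move=> e0 h; have [_ lb] := has_inf_prohorov_radii mu nu.
apply: ge_inf => //; split => // A mA; split; first exact: h.
have mB : measurable (~` thickening A e : set (borel X)).
  by apply: measurableC; exact: measurable_thickening.
have := h _ mB.
rewrite (probability_setC mu (measurable_thickening A e)).
have sub : thickening (~` thickening A e) e `<=` ~` A.
  move=> x /thickeningP[y yA xy] Ax; apply: yA; apply/thickeningP; exists x => //.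
  by rewrite metric_sym.
have : (nu (thickening (~` thickening A e) e) <= 1 - nu A)%E.
  rewrite -(probability_setC nu mA); apply: le_measure; rewrite ?inE//.
    exact: measurable_thickening.
  exact: measurableC.
move=> h1 h2; have {h1 h2} := le_trans h2 (leeD2r e%:E h1).
rewrite -(fineK (fin_num_measure mu _ (measurable_thickening A e))).
rewrite -(fineK (fin_num_measure nu _ mA)) -!EFinB -!EFinD !lee_fin.
by lra.
Qed.

(** Setwise agreement suffices for rewriting under [prohorov], without an equality of bundled
    probabilities. *)
Lemma eq_prohorov mu nu nu' : (forall A, nu A = nu' A) ->
  prohorov mu nu = prohorov mu nu'.
Proof.
move=> nunu'; congr inf; apply/seteqP; split => e [e0 h]; split => // A mA.
  by rewrite -!nunu'; exact: h.
by rewrite !nunu'; exact: h.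
Qed.

Arguments eq_prohorov mu {nu nu'}.

(** Whenever the atom [x i] lies in [A], its partner [y i] lies in the thickening of [A], so the
    counts compare term by term. *)
Lemma prohorov_empirical (N : nat) (x y : 'I_N.+1 -> X) e : 0 < e ->
  (forall i, mdist (x i) (y i) < e) -> prohorov (empirical x) (empirical y) <= e.
Proof.
move=> e0 xy; apply: prohorov_le => // A mA.
rewrite /= !empiricalE -EFinD lee_fin -[leLHS]addr0; apply: lerD; last exact: ltW.
rewrite ler_wpM2l// ?invr_ge0//; apply: ler_sum => i _.
rewrite ler_nat; case: (boolP (x i \in A)) => // /set_mem Ax.
rewrite mem_set//; apply/thickeningP; exists (x i) => //.
by rewrite metric_sym.
Qed.

(** Compactness gives a finite cover by [e]-balls; removing from each ball the earlier ones makes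
    the pieces disjoint. *)
Lemma finite_borel_partition e : compact [set: X] -> 0 < e ->
  exists m (c : nat -> X) (A : nat -> set X),
    [/\ forall j, measurable (A j : set (borel X)), trivIset setT A,
        forall j x, A j x -> mdist x (c j) < e &
        \big[setU/set0]_(j < m.+1) A j = setT].
Proof.
rewrite compact_cover => cX e0.
have [||D _ cD] := cX X setT (fun x => thickening [set x] e).
- by move=> x _; exact: open_thickening.
- by move=> x _; exists x => //; exact: sub_thickening.
pose s := finmap.enum_fset D; pose c j := nth point s j.
pose F j := thickening [set c j] e.
have mF j : measurable (F j : set (borel X)) by exact: measurable_thickening.
(* The piece of index [size s] comes from the ball around the default [point]; it makes the number
   of pieces a successor. *)
exists (size s), c, (seqDU F); split.
- move=> j; apply: measurableD => //.
  exact: bigsetU_measurable.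
- exact: trivIset_seqDU.
- by move=> j x [/thickeningP[_ ->]].
- rewrite -bigsetU_seqDU; apply/seteqP; split => // x _.
  have [a aD xa] := cD x I; rewrite -bigcup_mkord.
  exists (index a s); first by rewrite /= ltnS index_size.
  by rewrite /F /c nth_index.
Qed.

Lemma empirical_approx e : compact [set: X] -> 0 < e ->
  exists N, forall mu, exists x : 'I_N.+1 -> X, prohorov mu (empirical x) <= e.
Proof.
move=> cX e0; have [m [c [A [mA tA Ac cA]]]] := finite_borel_partition cX e0.
(* Then [N.+1 > m.+1 / e], so the rounding loss [m.+1 / N.+1] is below [e], whatever [mu] is. *)
pose N := Num.truncn (m.+1%:R / e); exists N => mu.
have muA (j : nat) : mu (A j) = (fine (mu (A j)))%:E.
  by rewrite fineK// fin_num_measure.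
have [||g hg] := @quantize_weights R m N.+1 (fun j => fine (mu (A j))).
- by move=> j; rewrite fine_ge0.
- rewrite -lee_fin -sumEFin.
  under eq_bigr do rewrite -muA.
  by rewrite -measure_bigsetU//; exact: (probability_le1 mu (bigsetU_measurable _ _)).
exists (c \o g); apply: prohorov_le => // B mB.
(* The pieces that meet [B] cover [B], and their centres lie in the [e]-thickening of [B]. *)
pose J j := `[< A j `&` B !=set0 >].
pose F j := if J j then A j else set0.
have mF j : measurable (F j : set (borel X)) by rewrite /F; case: ifP.
have BF : B `<=` \big[setU/set0]_(j < m.+1) F j.
  move=> x Bx; have : setT x by [].
  rewrite -cA -!bigcup_mkord => -[j /= jm Ax].
  by exists j => //; rewrite /F ifT//; apply/asboolP; exists x.
apply: (le_trans (content_subadditive mu (fun j _ => mF j) mB BF)).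
rewrite (eq_bigr (fun j : 'I_m.+1 =>
   (if J j then fine (mu (A j)) else 0)%:E)); last first.
  by move=> j _; rewrite /F; case: ifP => _; [exact: muA | rewrite measure0].
rewrite sumEFin -big_mkcond/= empiricalE -EFinD lee_fin.
rewrite -(ler_pM2l (_ : 0 < N.+1%:R))// (le_trans (hg J))//.
rewrite mulrDr mulrA divff ?pnatr_eq0// mul1r lerD//.
- apply: ler_sum => i _; rewrite ler_nat.
  case: (boolP (J (g i))) => // /asboolP[y [Ay By]].
  rewrite mem_set//; apply/thickeningP; exists y => //.
  by rewrite metric_sym; exact: Ac.
- by rewrite -ler_pdivrMr// ltW// truncnS_gt.
Qed.
End prohorov_bounds.

(** * Iterates of the induced system and transfer of weak mixing *)

Lemma orbit_map_induced (R : realType) (X : pointedMetricType R)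
    (f : nat -> X -> X) (cf : forall n, continuous (f n)) k
    (mu : borel_probability X) (A : set X) :
  orbit_map (induced_system cf) k mu A = mu (orbit_map f k @^-1` A).
Proof.
(* [A] stays general because the hypothesis is applied to its preimage under [f k]. *)
elim: k A => [//|k IH] A /=.
by rewrite [LHS]induced_mapE IH.
Qed.

Lemma orbit_map_empirical (R : realType) (X : pointedMetricType R)
    (f : nat -> X -> X) (cf : forall n, continuous (f n)) k N
    (x : 'I_N.+1 -> X) (A : set X) :
  orbit_map (induced_system cf) k (empirical x : borel_probability X) A =
  empirical (orbit_map f k \o x) A.
Proof.
by rewrite orbit_map_induced/= !empiricalE.
Qed.

Lemma weakly_mixing_induced (R : realType) (X : pointedMetricType R)
    (cX : compact [set: X])
    (f : nat -> X -> X) (cf : forall n, continuous (f n)) :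
  weakly_mixing_all_orders f -> weakly_mixing_all_orders (induced_system cf).
Proof.
move=> wm n n2 U V oU oV.
have [mu Umu] := choice (fun i => (oU i).2).
have [nu Vnu] := choice (fun i => (oV i).2).
(* Finitely many indices allow one radius for all the sets. *)
have [r r0 UV] : exists2 r : R, 0 < r & forall i,
    ball (mu i) r `<=` U i /\ ball (nu i) r `<=` V i.
  have : \forall r \near 0^'+, forall i,
      ball (mu i) r `<=` U i /\ ball (nu i) r `<=` V i.
    apply: filter_forall => i; have [oUi _] := oU i; have [oVi _] := oV i.
    have /nbhs_ballP[a /= a0 aU] : nbhs (mu i) (U i) by exact: open_nbhs_nbhs.
    have /nbhs_ballP[b /= b0 bV] : nbhs (nu i) (V i) by exact: open_nbhs_nbhs.
    near=> r; split.
      by apply: subset_trans aU; apply: le_ball; near: r; exact: nbhs_right_ltW.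
    by apply: subset_trans bV; apply: le_ball; near: r; exact: nbhs_right_ltW.
  move=> near_r; have [r [r0 hr]] :=
    filter_ex (filterI (nbhs_right_gt (0 : R)) near_r).
  by exists r.
(* Approximating by atoms and moving the atoms cost [e] each, and [2 * e < r]. *)
pose e := r / 3; have e0 : 0 < e by rewrite divr_gt0.
have [N approx] := empirical_approx cX e0.
have [x mux] := choice (fun i => approx (mu i)).
have [y nuy] := choice (fun i => approx (nu i)).
(* One pair of balls for each atom of each pair [(mu i, nu i)], so that a single time [k] serves
   them all. *)
pose J : finType := ('I_n * 'I_N.+1)%type.
have oth (z : J -> X) i :
    open (thickening [set z i] e) /\ thickening [set z i] e !=set0.
  split; first exact: open_thickening.
  by exists (z i); exact: sub_thickening.
have wmJ : weakly_mixing f #|{: J}|.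
  by apply: wm; rewrite card_prod !card_ord (leq_trans n2)// leq_pmulr.
have [k hk] := weakly_mixing_fin wmJ (oth (fun i => x i.1 i.2))
  (oth (fun i => y i.1 i.2)).
exists k => i _; split; first by have [] := hk (i, ord0).
(* The points [w] are the atoms of a measure near [mu i] whose image at time [k] is near [nu i]. *)
have {}hk j : exists w, mdist (x i j) w < e /\ mdist (y i j) (orbit_map f k w) < e.
  have [_ [_ [[w xw <-] yw]]] := hk (i, j); exists w.
  move: xw yw => /thickeningP[_ ->/= xw] /thickeningP[_ ->/= yw].
  by rewrite metric_sym (metric_sym (y i j)).
have [w hw] := choice hk; have [Ur Vr] := UV i.
have close (m m' m'' : borel_probability X) :
    prohorov m m' <= e -> prohorov m' m'' <= e -> ball m r m''.
  move=> h1 h2; rewrite ball_prohorov/=.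
  rewrite (le_lt_trans (prohorov_triangle m' _ _))//.
  by rewrite (le_lt_trans (lerD h1 h2))// /e; lra.
pose mw : borel_probability X := empirical w.
exists (orbit_map (induced_system cf) k mw); split.
  exists mw => //; apply: Ur; apply: close (mux i) _.
  by apply: prohorov_empirical => // j; have [] := hw j.
apply: Vr; apply: close (nuy i) _.
rewrite (eq_prohorov _ (orbit_map_empirical cf k w)).
by apply: prohorov_empirical => // j; have [] := hw j.
Unshelve. all: end_near. Qed.

Lemma weakly_mixing_of_induced (R : realType) (X : pointedMetricType R)
    (f : nat -> X -> X) (cf : forall n, continuous (f n)) n :
  weakly_mixing (induced_system cf) n -> weakly_mixing f n.
Proof.
move=> wm U V oU oV.
have concentrate (W : set X) : open W /\ W !=set0 ->
    exists B : set (borel_probability X), (open B /\ B !=set0) /\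
      forall mu, B mu -> (2^-1%:E < mu W)%E.
  move=> [oW [x Wx]].
  have /nbhs_ballP[r /= r0 rW] : nbhs x W by exact: open_nbhs_nbhs.
  (* For a radius [e < d], the bound [r / 2] gives [d + e < r], and the bound [2^-1] leaves mass
     [1 - e] above one half. *)
  have d2 : 0 < Num.min (r / 2) (2^-1) by rewrite lt_min divr_gt0/=.
  set d := Num.min _ _ in d2.
  pose dx : borel_probability X := \d_(x : borel X).
  exists (ball dx d)°; split.
    split; first exact: open_interior.
    by exists dx; apply: nbhsx_ballx.
  move=> mu /interior_subset; rewrite ball_prohorov/=.
  move=> /(inf_lt (has_inf_prohorov_radii _ _).1)[e [e0 he] ed].
  (* The Prohorov inequality is tested on this ball, which has full Dirac mass and whose
     [e]-thickening stays inside [W]. *)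
  pose T := thickening [set x] d.
  have mT : measurable (T : set (borel X)) by exact: measurable_thickening.
  have [+ _] := he T mT.
  rewrite /dx/= diracE mem_set; last exact: sub_thickening.
  have sub : thickening T e `<=` W.
    move=> y /thickeningD /thickeningP[_ -> xy]; apply: rW.
    rewrite ballEmdist/= metric_sym (lt_le_trans xy)//.
    have : d <= r / 2 by rewrite ge_min lexx.
    by lra.
  have mW : measurable (W : set (borel X)) by exact: sub_sigma_algebra.
  have : (mu (thickening T e) <= mu W)%E.
    by apply: le_measure; rewrite ?inE//; exact: measurable_thickening.
  have : d <= 2^-1 by rewrite ge_min lexx orbT.
  rewrite -(fineK (fin_num_measure mu _ (measurable_thickening T e))).
  rewrite -(fineK (fin_num_measure mu _ mW)) -EFinD !lee_fin lte_fin.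
  by rewrite mulr1n; move: ed; lra.
have [B hB] := choice (fun i => concentrate _ (oU i)).
have [C hC] := choice (fun i => concentrate _ (oV i)).
have [k hk] := wm B C (fun i => (hB i).1) (fun i => (hC i).1).
exists k => i _; have [k1 [_ [[mu Bmu <-] Cmu]]] := hk i I; split => //.
have := (hC i).2 _ Cmu; rewrite orbit_map_induced.
have := (hB i).2 _ Bmu.
set F := orbit_map f k.
have mW (W : set X) : open W -> measurable (W : set (borel X)).
  by move=> oW; exact: sub_sigma_algebra.
have mU := mW _ (oU i).1.
have mFV : measurable (F @^-1` V i : set (borel X)).
  apply: mW; have /continuousP := @continuous_orbit_map _ _ k cf.
  by apply; case: (oV i).
(* Otherwise [U i] lies in the complement of the preimage of [V i], and two masses above one half
   would add up to at most 1. *)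
have [//|disj] := pselect ((F @` U i) `&` V i !=set0).
have : (mu (U i) <= 1 - mu (F @^-1` V i))%E.
  rewrite -(probability_setC mu mFV); apply: le_measure; rewrite ?inE//.
    exact: measurableC.
  by move=> x Ux Vx; apply: disj; exists (F x); split => //; exists x.
rewrite -(fineK (fin_num_measure mu _ mU)) -(fineK (fin_num_measure mu _ mFV)).
by rewrite -EFinB lee_fin !lte_fin; lra.
Qed.

Theorem proposition2p9 (R : realType) (X : pointedMetricType R)
    (cX : compact [set: X])
    (f : nat -> X -> X) (cf : forall n, continuous (f n)) :
  (weakly_mixing_all_orders f ->
     weakly_mixing_all_orders (induced_system cf)) /\
  (forall n : nat, (2 <= n)%N ->
     weakly_mixing (induced_system cf) n -> weakly_mixing f n).
Proof.
split; first exact: weakly_mixing_induced.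
by move=> n _; exact: weakly_mixing_of_induced.
Qed.
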